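(* Let $A$ be an integral domain and $E$ an $A$-module. Then $qD_A(E)$ is a $T_0$-space.
   Context: For an $A$-module $E$: $\operatorname{ann}(E)=\{a\in A: aE=0\}$, $W(E)=\{a\in A: aE\neq E\}$, $W(E)^{\#}=W(E)\setminus\operatorname{ann}(E)$. On $W(E)^{\#}$ put $a\sim b$ iff $aE=bE$; $[a]$ is the class of $a$ and $\operatorname{EC}(W(E)^{\#})$ is the set of all classes. For $a\in W(E)^{\#}$, $U_a=\{[b]\in\operatorname{EC}(W(E)^{\#}): aE\subseteq bE\}$. The quasi divisor topology $qD_A(E)$ is the topological space $\operatorname{EC}(W(E)^{\#})$ whose topology has basis $\{U_a\}_{a\in W(E)^{\#}}$. *)

(* Defs.v *)
From HB Require Import structures.
From mathcomp Require Import all_boot all_order all_algebra generic_quotient.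
From mathcomp Require Import boolp classical_sets filter topology.

Set Implicit Arguments.
Unset Strict Implicit.
Unset Printing Implicit Defensive.

Import GRing.Theory.
Local Open Scope classical_set_scope.
Local Open Scope ring_scope.
Local Open Scope quotient_scope.

Section QuasiDivisor.
Context {A : idomainType} (E : lmodType A).
Implicit Types a b : A.

(* The submodule aE of E, as a set. *)
Definition scaled a : set E := [set a *: x | x in [set: E]].

Definition ann : set A := [set a | scaled a = [set 0]].

Definition W : set A := [set a | scaled a <> [set: E]].

Definition Wsharp : set A := W `\` ann.

Definition sim (a b : Wsharp) : bool := `[< scaled (val a) = scaled (val b) >].

Lemma sim_refl : reflexive sim.
Proof. by move=> a; apply/asboolP. Qed.

Lemma sim_sym : symmetric sim.
Proof. by move=> a b; apply/asboolP/asboolP. Qed.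

Lemma sim_trans : transitive sim.
Proof. by move=> b a c /asboolP ab /asboolP bc; apply/asboolP; rewrite ab. Qed.

Canonical sim_equiv := EquivRel sim sim_refl sim_sym sim_trans.

Definition EC : Type := {eq_quot sim}.
HB.instance Definition _ := Choice.on EC.
HB.instance Definition _ := EqQuotient.on EC.

Definition U (a : Wsharp) : set EC :=
  [set \pi_EC b | b in [set b : Wsharp | scaled (val a) `<=` scaled (val b)]].

(* The basis is indexed by itself: isBaseTopological asks for a pointed index
   type, and Wsharp may be empty. *)
Definition qD_base : set (set EC) := [set U a | a in [set: Wsharp]].

Lemma pi_ECP (a b : Wsharp) :
  \pi_EC a = \pi_EC b <-> scaled (val a) = scaled (val b).
Proof.
split=> [/eqP|ab]; first by rewrite eqmodE => /asboolP.
by apply/eqP; rewrite eqmodE; apply/asboolP.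
Qed.

Lemma in_U (a b : Wsharp) : U a (\pi_EC b) <-> scaled (val a) `<=` scaled (val b).
Proof.
split=> [[c /= ac /pi_ECP <-] //|ab].
by exists b.
Qed.

Lemma qD_base_cover : \bigcup_(V in qD_base) V = [set: EC].
Proof.
apply/seteqP; split=> // x _; elim/quotW: x => a.
by exists (U a); [exists a | apply/in_U].
Qed.

Lemma qD_base_join (V1 V2 : set EC) (x : EC) :
  qD_base V1 -> qD_base V2 -> V1 x -> V2 x ->
  exists V, [/\ qD_base V, V x & V `<=` V1 `&` V2].
Proof.
move=> [a _ <-] [b _ <-]; elim/quotW: x => c /in_U ac /in_U bc.
exists (U c); split; [by exists c | by apply/in_U |].
move=> y; elim/quotW: y => d /in_U cd.
by split; apply/in_U; apply: subset_trans cd.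
Qed.

Definition qD : Type := EC.
HB.instance Definition _ := Choice.on qD.
HB.instance Definition _ :=
  isBaseTopological.Build qD qD_base_cover qD_base_join.

Lemma qD_openE (O : set qD) :
  open O <-> exists2 F : set (set qD), F `<=` qD_base & \bigcup_(V in F) V = O.
Proof. by split. Qed.

End QuasiDivisor.

(* Main.v *)
Require Import Defs.
From HB Require Import structures.
From mathcomp Require Import all_boot all_order all_algebra.
From mathcomp Require Import boolp classical_sets filter topology.

(** The basic open set [U a] is the smallest open set containing the class of
    [a], and it contains the class of [b] exactly when [aE] is a subset of
    [bE].  The specialization preorder of the space is therefore inclusion of
    the submodules [aE].  Two points that no open set distinguishes satisfy both
    inclusions, so [aE = bE] and their classes coincide. *)

Local Open Scope classical_set_scope.
Local Open Scope quotient_scope.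

Lemma nbhs_U (A : idomainType) (E : lmodType A) (a : Wsharp E) :
  nbhs (\pi_(EC E) a : qD E) (U a).
Proof.
apply: open_nbhs_nbhs; split; last exact/in_U.
apply/qD_openE; exists [set U a]; last exact: bigcup_set1.
by move=> _ ->; exists a.
Qed.

Theorem proposition6 (A : idomainType) (E : lmodType A) :
  kolmogorov_space (qD E).
Proof.
move=> x y; elim/quotW: x => a; elim/quotW: y => b ab_neq.
have [ab|ab] := pselect (U a (\pi_(EC E) b)); last first.
  by exists (U a); left; split; rewrite inE //; exact: nbhs_U.
exists (U b); right; split; rewrite inE; first exact: nbhs_U.
move=> /in_U ba; move/eqP: ab_neq; apply; apply/pi_ECP.
by apply/seteqP; split=> //; apply/in_U.
Qed.
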